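(* Let $\Bbbk$ be a field and let $\mathcal{P}$ be a $\mathcal{C}om$-augmented Hopf operad over $\Bbbk$ of Gelfand-Kirillov dimension $\le 2$. Then $\mathcal{P}=\mathcal{C}om$ (that is, the unit map $u_{\mathcal{P}}:\mathcal{C}om\to\mathcal{P}$ is an isomorphism).
   Context: An operad is a symmetric operad in $\Bbbk$-vector spaces, with right $\Bbbk\mathbb{S}_n$-modules $\mathcal{P}(n)$ ($n\ge0$), identity $\mathbb{1}\in\mathcal{P}(1)$ and partial compositions $\circ_i$. All operads are locally finite: $\dim_{\Bbbk}\mathcal{P}(n)<\infty$ for all $n$. The Gelfand-Kirillov dimension is $\operatorname{GKdim}\mathcal{P}=\limsup_{n\to\infty}\log_n\left(\sum_{i=0}^n\dim_{\Bbbk}\mathcal{P}(i)\right)$. $\mathcal{C}om$ is the operad with $\mathcal{C}om(n)=\Bbbk\mathbb{1}_n$ for all $n\ge0$, trivial symmetric group actions and $\mathbb{1}_m\circ_i\mathbb{1}_n=\mathbb{1}_{m+n-1}$. An operad is unitary if $\mathcal{P}(0)=\Bbbk\mathbb{1}_0$ is one-dimensional with a chosen basis element $\mathbb{1}_0$. A $\mathcal{C}om$-augmented operad is a unitary operad $\mathcal{P}$ together with an operad morphism $u_{\mathcal{P}}:\mathcal{C}om\to\mathcal{P}$ preserving $\mathbb{1}_0$. The Hadamard product $\mathcal{P}\otimes_{\mathrm H}\mathcal{Q}$ has $(\mathcal{P}\otimes_{\mathrm H}\mathcal{Q})(n)=\mathcal{P}(n)\otimes\mathcal{Q}(n)$ with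 diagonal symmetric group action and $(\mu_1\otimes\nu_1)\circ_i(\mu_2\otimes\nu_2)=(\mu_1\circ_i\mu_2)\otimes(\nu_1\circ_i\nu_2)$; $\mathcal{C}om$ is a unit for it. A Hopf operad is an operad $\mathcal{P}$ with operad morphisms $\Delta:\mathcal{P}\to\mathcal{P}\otimes_{\mathrm H}\mathcal{P}$ (coproduct) and $\epsilon:\mathcal{P}\to\mathcal{C}om$ (counit) that are coassociative and counital. A $\mathcal{C}om$-augmented Hopf operad is a Hopf operad $\mathcal{P}$ that is $\mathcal{C}om$-augmented via $u_{\mathcal{P}}$ such that (1) $\epsilon\circ u_{\mathcal{P}}=\mathrm{id}_{\mathcal{C}om}$, and (2) $\Delta\circ u_{\mathcal{P}}$ equals the composite $\mathcal{C}om\cong\mathcal{C}om\otimes_{\mathrm H}\mathcal{C}om\xrightarrow{u_{\mathcal{P}}\otimes u_{\mathcal{P}}}\mathcal{P}\otimes_{\mathrm H}\mathcal{P}$. *)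

(* Defs.v *)
From HB Require Import structures.
From mathcomp Require Import all_boot all_order all_fingroup all_algebra.
From mathcomp Require Import all_classical all_reals all_analysis.
Set Implicit Arguments.
Unset Strict Implicit.
Unset Printing Implicit Defensive.
Import Order.TTheory GRing.Theory Num.Theory VectorInternalTheory.
Local Open Scope ring_scope.

(* Inputs are numbered from 0.  For [p.+1 = m + n] and [i : 'I_m], the p inputs *)
(* of [f o_i g] (f of arity m, g of arity n) are the inputs of g together with  *)
(* the inputs of f other than i.                                                *)
Section Slots.
Variables (m n p : nat) (e : p.+1 = (m + n)%N).

Fact inner_slot_subproof (i : 'I_m) (j : 'I_n) : (i + j < p)%N.
Proof. by rewrite -ltnS e -addSn -addnS leq_add. Qed.

Definition inner_slot (i : 'I_m) (j : 'I_n) : 'I_p :=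
  Ordinal (inner_slot_subproof i j).

Definition outer_index (i k : nat) : nat :=
  if (k < i)%N then k else (k + n).-1.

Fact outer_slot_subproof (i k : 'I_m) : k != i -> (outer_index i k < p)%N.
Proof.
rewrite -val_eqE /= neq_ltn /outer_index => /orP[] ki.
  rewrite ki -ltnS e; apply: leq_trans (leq_addr n m).
  exact: leq_ltn_trans ki (ltn_ord i).
rewrite [(k < i)%N]ltnNge (ltnW ki) /= -ltnS e prednK.
  by rewrite -addSn leq_add2r.
by rewrite (leq_trans _ (leq_addr _ _)) // (leq_ltn_trans _ ki).
Qed.

Definition outer_slot (i k : 'I_m) (ki : k != i) : 'I_p :=
  Ordinal (outer_slot_subproof ki).

Definition glue (i : 'I_m) (x : 'I_n + {k : 'I_m | k != i}) : 'I_p :=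
  match x with
  | inl j => inner_slot i j
  | inr k => outer_slot (valP k)
  end.

Lemma glue_inj (i : 'I_m) : injective (@glue i).
Proof.
have inout (j : 'I_n) (k : 'I_m) : k != i -> (i + j)%N <> outer_index i k.
  rewrite -val_eqE /= neq_ltn /outer_index => /orP[] ki.
    by rewrite ki => E; move: ki; rewrite -E ltnNge leq_addr.
  rewrite [(k < i)%N]ltnNge (ltnW ki) /= => E.
  have : (i + j < (k + n).-1)%N.
    rewrite -ltnS prednK; last by rewrite addn_gt0 (leq_ltn_trans _ ki).
    by rewrite -addSn -addnS leq_add.
  by rewrite -E ltnn.
move=> [j|[k ki]] [j'|[k' ki']] /(congr1 val) /= E.
- by congr inl; apply: val_inj; apply: (@addnI i).
- by case: (inout j k' ki').
- by case: (inout j' k ki).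
congr inr; apply: val_inj => /=; apply: val_inj => /=; move: E.
move: ki ki'; rewrite -!val_eqE /= !neq_ltn /outer_index => /orP[] ki /orP[] ki'.
- by rewrite ki ki'.
- rewrite ki [(k' < i)%N]ltnNge (ltnW ki') /= => E.
  have : (i <= (k' + n).-1)%N.
    by rewrite -ltnS prednK ?(leq_trans ki') ?leq_addr ?addn_gt0 ?(leq_ltn_trans _ ki').
  by rewrite -E leqNgt ki.
- rewrite ki' [(k < i)%N]ltnNge (ltnW ki) /= => E.
  have : (i <= (k + n).-1)%N.
    by rewrite -ltnS prednK ?(leq_trans ki) ?leq_addr ?addn_gt0 ?(leq_ltn_trans _ ki).
  by rewrite E leqNgt ki'.
rewrite ![(_ < i)%N]ltnNge (ltnW ki) (ltnW ki') /= => /(congr1 succn).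
rewrite !prednK; first exact: addIn.
  by rewrite addn_gt0 (leq_ltn_trans _ ki').
by rewrite addn_gt0 (leq_ltn_trans _ ki).
Qed.

Lemma glue_surj (i : 'I_m) (x : 'I_p) : x \in codom (@glue i).
Proof.
apply: (inj_card_onto (@glue_inj i)).
rewrite card_ord card_sum card_ord card_sig cardC1 card_ord -ltnS e.
by rewrite addnC -addnS prednK ?leqnn // (leq_ltn_trans _ (ltn_ord i)).
Qed.

Definition unglue (i : 'I_m) (x : 'I_p) : 'I_n + {k : 'I_m | k != i} :=
  iinv (glue_surj i x).

Lemma unglueK i : cancel (@unglue i) (@glue i).
Proof. by move=> x; apply: f_iinv. Qed.

Lemma glueK i : cancel (@glue i) (@unglue i).
Proof. by move=> x; apply: iinv_f; apply: glue_inj. Qed.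

Fact relabel_subproof (s : 'S_m) (i k : 'I_m) : k != i -> s k != s i.
Proof. by rewrite (inj_eq perm_inj). Qed.

Definition relabel (s : 'S_m) (t : 'S_n) (i : 'I_m)
    (x : 'I_n + {k : 'I_m | k != i}) : 'I_n + {k : 'I_m | k != s i} :=
  match x with
  | inl j => inl (t j)
  | inr k => inr (exist _ (s (val k)) (relabel_subproof s (valP k)))
  end.

Lemma relabel_inj (s : 'S_m) (t : 'S_n) (i : 'I_m) : injective (@relabel s t i).
Proof.
move=> [j|k] [j'|k'] //= [] => [/perm_inj -> //|/perm_inj E].
by congr inr; apply: val_inj.
Qed.

Definition circ_perm_fun (i : 'I_m) (s : 'S_m) (t : 'S_n) (x : 'I_p) : 'I_p :=
  glue (relabel s t (unglue i x)).

Fact circ_perm_subproof (i : 'I_m) (s : 'S_m) (t : 'S_n) : injective (circ_perm_fun i s t).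
Proof.
by move=> x y /glue_inj /relabel_inj /(can_inj (@unglueK i)).
Qed.

(* The composite [s o_i t] of permutations. *)
Definition circ_perm (i : 'I_m) (s : 'S_m) (t : 'S_n) : 'S_p :=
  perm (@circ_perm_subproof i s t).

Lemma circ_perm_inner (i : 'I_m) (s : 'S_m) (t : 'S_n) (j : 'I_n) :
  circ_perm i s t (inner_slot i j) = inner_slot (s i) (t j).
Proof. by rewrite permE /circ_perm_fun (glueK (inl j)). Qed.

Lemma circ_perm_outer (i : 'I_m) (s : 'S_m) (t : 'S_n) (k : 'I_m) (ki : k != i) (ski : s k != s i) :
  circ_perm i s t (outer_slot ki) = outer_slot ski.
Proof.
rewrite permE /circ_perm_fun.
have -> : outer_slot ki = glue (inr (exist (fun k => k != i) k ki)).
  exact: val_inj.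
by rewrite glueK; apply: val_inj.
Qed.

End Slots.

(* [op_circ e i f g] is f o_(i+1) g; carrying the arity equation [p.+1 = m + n] *)
(* avoids transporting elements along equalities between arities.  The right    *)
(* action is the one for which [f.s] feeds its j-th input to the [s j]-th input *)
(* of f, i.e. (f.s)(x_1,...,x_n) = f(x_(s^-1 1),...,x_(s^-1 n)); it is a right  *)
(* action for the product of permutations "first t, then s", which is           *)
(* [(t * s)%g] in MathComp.  Local finiteness is built in: every component is a *)
(* finite-dimensional space.                                                    *)
Record operad (K : fieldType) := Operad {
  op_space :> nat -> vectType K;
  op_act : forall n, op_space n -> 'S_n -> op_space n;
  op_id : op_space 1;
  op_circ : forall m n p, p.+1 = (m + n)%N -> 'I_m ->
    op_space m -> op_space n -> op_space p;
  op_act_linear : forall n (s : 'S_n), linear (fun f => op_act f s);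
  op_act1 : forall n (f : op_space n), op_act f 1%g = f;
  op_actM : forall n (f : op_space n) (s t : 'S_n),
    op_act (op_act f s) t = op_act f (t * s)%g;
  op_circ_linearl : forall m n p (e : p.+1 = (m + n)%N) (i : 'I_m)
    (g : op_space n), linear (fun f => op_circ e i f g);
  op_circ_linearr : forall m n p (e : p.+1 = (m + n)%N) (i : 'I_m)
    (f : op_space m), linear (fun g => op_circ e i f g);
  op_id_circ : forall n (e : n.+1 = (1 + n)%N) (f : op_space n),
    op_circ e ord0 op_id f = f;
  op_circ_id : forall n (e : n.+1 = (n + 1)%N) (i : 'I_n) (f : op_space n),
    op_circ e i f op_id = f;
  op_circA : forall l m n p q r
    (elm : p.+1 = (l + m)%N) (epn : r.+1 = (p + n)%N)
    (emn : q.+1 = (m + n)%N) (elq : r.+1 = (l + q)%N)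
    (i : 'I_l) (j : 'I_m)
    (f : op_space l) (g : op_space m) (h : op_space n),
    op_circ epn (inner_slot elm i j) (op_circ elm i f g) h =
    op_circ elq i f (op_circ emn j g h);
  op_circAC : forall l m n p q r
    (elm : p.+1 = (l + m)%N) (epn : r.+1 = (p + n)%N)
    (eln : q.+1 = (l + n)%N) (eqm : r.+1 = (q + m)%N)
    (i k : 'I_l) (ki : k != i) (ik : i != k)
    (f : op_space l) (g : op_space m) (h : op_space n),
    op_circ epn (outer_slot elm ki) (op_circ elm i f g) h =
    op_circ eqm (outer_slot eln ik) (op_circ eln k f h) g;
  op_circ_act : forall m n p (e : p.+1 = (m + n)%N) (i : 'I_m)
    (s : 'S_m) (t : 'S_n) (f : op_space m) (g : op_space n),
    op_circ e i (op_act f s) (op_act g t) =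
    op_act (op_circ e (s i) f g) (circ_perm e i s t)
}.

Record operad_hom (K : fieldType) (P Q : operad K) := OperadHom {
  hom_fun :> forall n, {linear P n -> Q n};
  hom_act : forall n (f : P n) (s : 'S_n),
    hom_fun n (op_act f s) = op_act (hom_fun n f) s;
  hom_id : hom_fun 1 (op_id P) = op_id Q;
  hom_circ : forall m n p (e : p.+1 = (m + n)%N) (i : 'I_m)
    (f : P m) (g : P n),
    hom_fun p (op_circ e i f g) = op_circ e i (hom_fun m f) (hom_fun n g)
}.

Definition is_operad_iso (K : fieldType) (P Q : operad K)
    (u : operad_hom P Q) : Prop :=
  exists v : operad_hom Q P, forall n, cancel (u n) (v n) /\ cancel (v n) (u n).

(* The terms n = 0, 1, where log_n is meaningless, do not affect the limsup.    *)
(* Since [ln 0 = 0], the zero operad gets 0 instead of -oo; for an operad with  *)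
(* P(0) nonzero all the sums are positive.                                      *)
Definition GKdim (R : realType) (K : fieldType) (P : operad K) : \bar R :=
  limn_esup (fun n : nat =>
    (ln (\sum_(i < n.+1) \dim {:P i})%N%:R / ln n%:R)%:E).

(* Tensor products of finite-dimensional spaces, modelled by coordinate         *)
(* matrices; [tens] is universal bilinear by [tliftE], [tens_ind] and           *)
(* [tlift_linear].                                                              *)
Section Tensor.
Variable K : fieldType.

Definition tensor (U V : vectType K) : vectType K := 'M[K]_(dim U, dim V).

Definition tens (U V : vectType K) (u : U) (v : V) : tensor U V :=
  (v2r u)^T *m v2r v.

Definition tbase (U : vectType K) (i : 'I_(dim U)) : U := r2v (delta_mx 0 i).

Definition tlift (U V W : vectType K) (b : U -> V -> W) (A : tensor U V) : W :=
  \sum_i \sum_j (A : 'M[K]_(_, _)) i j *: b (tbase i) (tbase j).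

Definition tmap (U V U' V' : vectType K) (f : U -> U') (g : V -> V') :
    tensor U V -> tensor U' V' :=
  tlift (fun u v => tens (f u) (g v)).

Definition tassoc (U V W : vectType K) :
    tensor (tensor U V) W -> tensor U (tensor V W) :=
  tlift (fun (A : tensor U V) w => tlift (fun u v => tens u (tens v w)) A).

Lemma tens_linearl (U V : vectType K) (v : V) :
  linear (fun u : U => tens u v).
Proof. by move=> a x y; rewrite /tens !linearP/= mulmxDl -scalemxAl. Qed.

Lemma tens_linearr (U V : vectType K) (u : U) :
  linear (fun v : V => tens u v).
Proof. by move=> a x y; rewrite /tens !linearP/= . Qed.

Lemma tlift_linear (U V W : vectType K) (b : U -> V -> W) : linear (tlift b).
Proof.
move=> a A B; rewrite /tlift scaler_sumr -big_split; apply: eq_bigr => i _ /=.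
rewrite scaler_sumr -big_split; apply: eq_bigr => j _ /=.
by rewrite !mxE scalerDl scalerA.
Qed.

Lemma linear_sumZ (U V : vectType K) (f : U -> V) (n : nat) (c : 'I_n -> K)
    (x : 'I_n -> U) :
  linear f -> f (\sum_i c i *: x i) = \sum_i c i *: f (x i).
Proof.
move=> fL; pose F := HB.pack_for {linear U -> V} f (GRing.isLinear.Build _ _ _ _ f fL).
rewrite -[f]/(F : U -> V) linear_sum; apply: eq_bigr => i _; exact: linearZ.
Qed.

Lemma tbase_sum (U : vectType K) (u : U) : u = \sum_i v2r u 0 i *: tbase i.
Proof.
rewrite -{1}[u]v2rK [v2r u in LHS]row_sum_delta linear_sum.
by apply: eq_bigr => i _; rewrite linearZ.
Qed.

Lemma tliftE (U V W : vectType K) (b : U -> V -> W) (u : U) (v : V) :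
  (forall v, linear (b^~ v)) -> (forall u, linear (b u)) ->
  tlift b (tens u v) = b u v.
Proof.
move=> bl br; rewrite [in RHS](tbase_sum u) (linear_sumZ _ _ (bl v)).
apply: eq_bigr => i _.
rewrite [in RHS](tbase_sum v) (linear_sumZ _ _ (br _)) scaler_sumr.
by apply: eq_bigr => j _; rewrite scalerA !mxE big_ord1 !mxE.
Qed.

Lemma tens_ind (U V : vectType K) (T : tensor U V -> Prop) :
  (forall a A B, T A -> T B -> T (a *: A + B)) ->
  (forall u v, T (tens u v)) -> forall A, T A.
Proof.
move=> TP Tt A.
have T0 : T 0 by rewrite -(addNr (tens 0 0)) -scaleN1r; apply: TP.
rewrite [A]matrix_sum_delta; elim/big_ind: _ => [//|x y Tx Ty|i _].
  by rewrite -[x]scale1r; apply: TP.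
elim/big_ind: _ => [//|x y Tx Ty|j _]; first by rewrite -[x]scale1r; apply: TP.
rewrite -[_ *: _]addr0; apply: TP => //.
suff -> : delta_mx i j = tens (tbase i) (tbase j) by [].
by rewrite /tens /tbase !r2vK trmx_delta mul_delta_mx.
Qed.

End Tensor.

Section Hadamard.
Variables (K : fieldType) (P Q : operad K).

Let H n : vectType K := tensor (P n) (Q n).

Definition had_act n (A : H n) (s : 'S_n) : H n :=
  tmap (fun f => op_act f s) (fun g => op_act g s) A.

Definition had_circ m n p (e : p.+1 = (m + n)%N) (i : 'I_m)
    (A : H m) (B : H n) : H p :=
  tlift (fun f1 g1 =>
    tlift (fun f2 g2 => tens (op_circ e i f1 f2) (op_circ e i g1 g2)) B) A.

Lemma had_actE n (f : P n) (g : Q n) s :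
  had_act (tens f g) s = tens (op_act f s) (op_act g s).
Proof.
rewrite /had_act /tmap tliftE // => [v|u] a x y.
  by rewrite (op_act_linear s) tens_linearl.
by rewrite (op_act_linear s) tens_linearr.
Qed.

Lemma had_act_linear n (s : 'S_n) : linear (fun A : H n => had_act A s).
Proof. exact: tlift_linear. Qed.

Lemma had_circ_linearl m n p (e : p.+1 = (m + n)%N) (i : 'I_m) (B : H n) :
  linear (fun A => had_circ e i A B).
Proof. exact: tlift_linear. Qed.

Lemma had_circ_linearr m n p (e : p.+1 = (m + n)%N) (i : 'I_m) (A : H m) :
  linear (fun B => had_circ e i A B).
Proof.
move=> a B C; rewrite /had_circ {1 3 5}/tlift scaler_sumr -big_split.
apply: eq_bigr => k _ /=; rewrite scaler_sumr -big_split.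
apply: eq_bigr => l _ /=; rewrite tlift_linear scalerDr !scalerA.
by rewrite mulrC.
Qed.

Lemma had_circE m n p (e : p.+1 = (m + n)%N) (i : 'I_m)
    (f1 : P m) (g1 : Q m) (f2 : P n) (g2 : Q n) :
  had_circ e i (tens f1 g1) (tens f2 g2) =
  tens (op_circ e i f1 f2) (op_circ e i g1 g2).
Proof.
have E f g : tlift (fun f2 g2 => tens (op_circ e i f f2) (op_circ e i g g2))
    (tens f2 g2) = tens (op_circ e i f f2) (op_circ e i g g2).
  rewrite tliftE // => [v|u] a x y.
    by rewrite (op_circ_linearr e i) tens_linearl.
  by rewrite (op_circ_linearr e i) tens_linearr.
rewrite /had_circ tliftE // => [v|u] a x y; rewrite !E.
  by rewrite (op_circ_linearl e i) tens_linearl.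
by rewrite (op_circ_linearl e i) tens_linearr.
Qed.

Definition hadamard : operad K.
Proof.
refine (@Operad K H had_act (tens (op_id P) (op_id Q)) had_circ
  had_act_linear _ _ had_circ_linearl had_circ_linearr _ _ _ _ _).
- move=> n; elim/tens_ind => [a A B IA IB|f g].
    by rewrite had_act_linear IA IB.
  by rewrite had_actE !op_act1.
- move=> n A s t; elim/tens_ind: A => [a A B IA IB|f g].
    by rewrite !had_act_linear IA IB.
  by rewrite !had_actE !op_actM.
- move=> n e; elim/tens_ind => [a A B IA IB|f g].
    by rewrite had_circ_linearr IA IB.
  by rewrite had_circE !op_id_circ.
- move=> n e i; elim/tens_ind => [a A B IA IB|f g].
    by rewrite had_circ_linearl IA IB.
  by rewrite had_circE !op_circ_id.
- move=> l m n p q r elm epn emn elq i j A B C.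
  elim/tens_ind: A => [a A A' IA IA'|f g].
    by rewrite !had_circ_linearl IA IA'.
  elim/tens_ind: B => [a B B' IB IB'|f' g'].
    rewrite had_circ_linearr 2!had_circ_linearl had_circ_linearr.
    by rewrite IB IB'.
  elim/tens_ind: C => [a C C' IC IC'|f'' g''].
    by rewrite !had_circ_linearr IC IC'.
  by rewrite !had_circE; congr tens; apply: op_circA.
- move=> l m n p q r elm epn eln eqm i k ki ik A B C.
  elim/tens_ind: A => [a A A' IA IA'|f g].
    by rewrite !had_circ_linearl IA IA'.
  elim/tens_ind: B => [a B B' IB IB'|f' g'].
    by rewrite !had_circ_linearr had_circ_linearl IB IB'.
  elim/tens_ind: C => [a C C' IC IC'|f'' g''].
    by rewrite !had_circ_linearr had_circ_linearl IC IC'.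
  by rewrite !had_circE; congr tens; apply: op_circAC.
- move=> m n p e i s t A B.
  elim/tens_ind: A => [a A A' IA IA'|f g].
    by rewrite had_act_linear !had_circ_linearl had_act_linear IA IA'.
  elim/tens_ind: B => [a B B' IB IB'|f' g'].
    by rewrite had_act_linear !had_circ_linearr had_act_linear IB IB'.
  by rewrite !had_actE !had_circE had_actE !op_circ_act.
Defined.

End Hadamard.

(* The basis element 1_n of Com(n) is [1 : K^o]. *)
Definition Com (K : fieldType) : operad K.
Proof.
refine (@Operad K (fun _ => K^o) (fun _ f _ => f) 1 (fun _ _ _ _ _ f g => f * g)
  _ _ _ _ _ _ _ _ _ _) => //.
- by move=> ? ? ? ? ? g a x y; rewrite mulrDl -scalerAl.
- by move=> ? ? ? ? ? g a x y; rewrite mulrDr -scalerAr.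
- by move=> *; rewrite mul1r.
- by move=> *; rewrite mulr1.
- by move=> *; rewrite mulrA.
- by move=> *; rewrite mulrAC.
Defined.

(* The first two fields say that P is unitary, P(0) = K 1_0. *)
Record com_augmentation (K : fieldType) (P : operad K) := ComAugmentation {
  aug_one0 : P 0%N;
  aug_one0_basis : basis_of {:P 0%N} [:: aug_one0];
  aug_unit : operad_hom (Com K) P;
  aug_unit0 : aug_unit 0%N (1 : K^o) = aug_one0
}.

(* The isomorphisms P ~ Com (x) P and P ~ P (x) Com are f |-> 1_n (x) f and     *)
(* f |-> f (x) 1_n.                                                             *)
Record hopf_structure (K : fieldType) (P : operad K) := HopfStructure {
  coprod : operad_hom P (hadamard P P);
  counit : operad_hom P (Com K);
  coprod_coassoc : forall n (f : P n),
    tassoc (tmap (coprod n) idfun (coprod n f)) =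
    tmap idfun (coprod n) (coprod n f);
  coprod_counitl : forall n (f : P n),
    tmap (counit n) idfun (coprod n f) = tens (1 : K^o) f;
  coprod_counitr : forall n (f : P n),
    tmap idfun (counit n) (coprod n f) = tens f (1 : K^o)
}.

Record com_augmented_hopf_operad (K : fieldType) := ComAugmentedHopfOperad {
  cah_operad :> operad K;
  cah_aug : com_augmentation cah_operad;
  cah_hopf : hopf_structure cah_operad;
  cah_counit_unit : forall n (a : Com K n),
    counit cah_hopf n (aug_unit cah_aug n a) = a;
  cah_coprod_unit : forall n (a : Com K n),
    coprod cah_hopf n (aug_unit cah_aug n a) =
    tmap (aug_unit cah_aug n) (aug_unit cah_aug n) (tens a (1 : K^o))
}.

(* Main.v *)
(* Composition with 1_0 deletes an input.  Suppose some nonzero v of arity at   *)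
(* least 2 is killed by deleting either of its first two inputs.  Padding v     *)
(* with dummy inputs on the right gives such elements in every larger arity;    *)
(* since the deletions of the first and of the second input split, this makes   *)
(* dim P(n) grow at least quadratically, hence GKdim P >= 3.                    *)
(* So no such v exists.  If u in P(1) has counit 0, then u(x) u(y) is killed by *)
(* both deletions, hence vanishes; but deleting y on the left and x on the      *)
(* right of its coproduct gives u (x) u, so u = 0 and P(1) = K 1_1.  In arity   *)
(* n+1 >= 2, subtract from f its counit times 1_(n+1): the deletions of the     *)
(* result lie in P(n) = K 1_n and have counit 0, so it is zero.                 *)
From HB Require Import structures.
Require Import Defs.
From mathcomp Require Import all_boot all_order all_fingroup all_algebra.
From mathcomp Require Import all_classical all_reals all_analysis.
From mathcomp Require Import zify.
Set Implicit Arguments.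
Unset Strict Implicit.
Unset Printing Implicit Defensive.
Import Order.TTheory GRing.Theory Num.Theory VectorInternalTheory.
Local Open Scope ring_scope.

(** The growth half sums three times. The common kernel of the first two deletions, once nonzero,
    has dimension at least 1 in every larger arity ([ker01_neq0]). The split deletions turn this
    into $j$ for the kernel of the first one ([dim_ker01]) and $\binom{j}{2}$ for the whole
    component ([dim_ker0]), hence $\binom{j+1}{3}$ for the partial sums ([sum_dim_growth]). Cubic
    growth contradicts the bound 2 ([log_growth_gt2]). The Hopf half is [arity1_rigid] and
    [unit_surjective]; the inverse of the unit is the counit. *)

Lemma dimv_img_ker (K : fieldType) (A B : vectType K) (f : 'Hom(A, B))
    (W : {vspace A}) (V : {vspace B}) :
  (V <= f @: W)%VS -> (\dim V + \dim (W :&: lker f) <= \dim W)%N.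
Proof. by move=> VW; rewrite -(limg_ker_dim f W) addnC leq_add2l dimvS. Qed.

(** * Tensors and contraction with the ground field *)

Lemma tmapE (K : fieldType) (U V U' V' : vectType K)
    (f : {linear U -> U'}) (g : {linear V -> V'}) u v :
  tmap f g (tens u v) = tens (f u) (g v).
Proof.
rewrite /tmap tliftE // => [w|w] a x y; rewrite linearP.
  by rewrite tens_linearl.
by rewrite tens_linearr.
Qed.

Lemma tensZl (K : fieldType) (U V : vectType K) (c : K) (u : U) (v : V) :
  tens (c *: u) v = c *: tens u v.
Proof. exact: (scalable_linear (tens_linearl v)). Qed.

Lemma tensZr (K : fieldType) (U V : vectType K) (c : K) (u : U) (v : V) :
  tens u (c *: v) = c *: tens u v.
Proof. exact: (scalable_linear (tens_linearr u)). Qed.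

(** The diagonal entries of the coordinate matrix are the squares of the coordinates of [u]. *)
Lemma tens_diag_eq0 (K : fieldType) (U : vectType K) (u : U) :
  tens u u = 0 -> u = 0.
Proof.
move=> uu0; apply: (can_inj v2rK); rewrite linear0; apply/rowP => i.
move/matrixP: uu0 => /(_ i i); rewrite !mxE big_ord1 !mxE => /eqP.
by rewrite mulf_eq0 orbb => /eqP.
Qed.

Definition contractl (K : fieldType) (U : vectType K) :
    tensor (K^o : vectType K) U -> U :=
  tlift (fun (c : K^o) u => (c : K) *: u).

Definition contractr (K : fieldType) (U : vectType K) :
    tensor U (K^o : vectType K) -> U :=
  tlift (fun u (c : K^o) => (c : K) *: u).

Lemma contractlE (K : fieldType) (U : vectType K) (c : K) (u : U) :
  contractl (tens (c : K^o) u) = c *: u.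
Proof.
rewrite /contractl tliftE // => [v|d] a x y; first by rewrite scalerDl scalerA.
by rewrite scalerDr !scalerA mulrC.
Qed.

Lemma contractrE (K : fieldType) (U : vectType K) (c : K) (u : U) :
  contractr (tens u (c : K^o)) = c *: u.
Proof.
rewrite /contractr tliftE // => [d|v] a x y; last by rewrite scalerDl scalerA.
by rewrite scalerDr !scalerA mulrC.
Qed.

Lemma op_circZl (K : fieldType) (P : operad K) m n p (e : p.+1 = (m + n)%N)
    (i : 'I_m) (c : K) (f : P m) (g : P n) :
  op_circ e i (c *: f) g = c *: op_circ e i f g.
Proof. exact: (scalable_linear (op_circ_linearl e i g)). Qed.

Lemma op_circZr (K : fieldType) (P : operad K) m n p (e : p.+1 = (m + n)%N)
    (i : 'I_m) (c : K) (f : P m) (g : P n) :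
  op_circ e i f (c *: g) = c *: op_circ e i f g.
Proof. exact: (scalable_linear (op_circ_linearr e i f)). Qed.

(** * Deletion of inputs and growth of dimensions *)

Section Deletion.
Variables (K : fieldType) (P : operad K) (au : com_augmentation P).

Let one n : P n := aug_unit au n (1 : K^o).

Fact delete_arity n : n.+1 = (n.+1 + 0)%N. Proof. by rewrite addn0. Qed.

Definition delete_fun n (i : 'I_n.+1) (f : P n.+1) : P n :=
  op_circ (delete_arity n) i f (one 0).

Fact delete_linear n (i : 'I_n.+1) : linear (delete_fun i).
Proof. exact: op_circ_linearl. Qed.

HB.instance Definition _ n (i : 'I_n.+1) :=
  GRing.isLinear.Build _ _ _ _ (delete_fun i) (delete_linear i).

Definition delete n (i : 'I_n.+1) : 'Hom(P n.+1, P n) := linfun (delete_fun i).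

(** The arity proof [e] is arbitrary, so that composites produced by [op_circA] and [op_circAC] can
    be folded back into deletions. *)
Lemma deleteE n (i : 'I_n.+1) (e : n.+1 = (n.+1 + 0)%N) f :
  delete i f = op_circ e i f (one 0).
Proof. by rewrite lfunE /= /delete_fun (eq_irrelevance e (delete_arity n)). Qed.

Lemma circ_one m n p (e : p.+1 = (m + n)%N) (i : 'I_m) :
  op_circ e i (one m) (one n) = one p.
Proof. by rewrite /one -hom_circ /= mulr1. Qed.

Lemma one1 : one 1 = op_id P.
Proof. exact: (hom_id (aug_unit au)). Qed.

Lemma delete_one n (i : 'I_n.+1) : delete i (one n.+1) = one n.
Proof. by rewrite (deleteE _ (delete_arity n)) circ_one. Qed.

Fact pad_arity n : n.+2 = (2 + n)%N. Proof. by []. Qed.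

(* [padl f] is x_0 f(x_1,...,x_n) and [padr f] is f(x_0,...,x_(n-1)) x_n. *)
Definition padl n (f : P n) : P n.+1 := op_circ (pad_arity n) ord_max (one 2) f.
Definition padr n (f : P n) : P n.+1 := op_circ (pad_arity n) ord0 (one 2) f.

Fact dup_arity n : n.+3 = (n.+1 + 2)%N. Proof. by rewrite addn2. Qed.

(** This is $f(x_0x_1,x_2,\dots,x_{n+1})$. *)
Definition dup n (f : P n.+1) : P n.+2 :=
  op_circ (dup_arity n) ord0 f (one 2).

(** By the parallel axiom $\mathbb{1}_0$ can be inserted before [f]; it turns $\mathbb{1}_2$ into
    the identity. *)
Lemma delete0_padl n (f : P n) : delete ord0 (padl f) = f.
Proof.
have ki : (ord0 : 'I_2) != ord_max by [].
have ik : (ord_max : 'I_2) != ord0 by [].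
have e : 2 = (2 + 0)%N by [].
have e' : n.+1 = (1 + n)%N by [].
rewrite (deleteE _ (delete_arity n)) /padl.
have -> : ord0 = outer_slot (pad_arity n) ki by apply: val_inj.
rewrite (op_circAC _ _ e e' ki ik) circ_one one1.
have -> : outer_slot e ik = ord0 by apply: val_inj.
exact: op_id_circ.
Qed.

Lemma delete_max_padr n (f : P n) : delete ord_max (padr f) = f.
Proof.
have ki : (ord0 : 'I_2) != ord_max by [].
have ik : (ord_max : 'I_2) != ord0 by [].
have e : 2 = (2 + 0)%N by [].
have e' : n.+1 = (1 + n)%N by [].
rewrite (deleteE _ (delete_arity n)) /padr.
have -> : ord_max = outer_slot (pad_arity n) ik by apply: val_inj.
rewrite (op_circAC _ _ e e' ik ki) circ_one one1.
have -> : outer_slot e ki = ord0 by apply: val_inj.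
exact: op_id_circ.
Qed.

Lemma delete_padr n (i : 'I_n.+1) (f : P n.+1) :
  delete (widen_ord (leqnSn _) i) (padr f) = padr (delete i f).
Proof.
rewrite (deleteE _ (delete_arity n.+1)) (deleteE _ (delete_arity n)) /padr.
have -> : widen_ord (leqnSn _) i = inner_slot (pad_arity n.+1) ord0 i.
  exact: val_inj.
exact: op_circA.
Qed.

Lemma delete1_padl n (f : P n.+1) :
  delete (lift ord0 ord0) (padl f) = padl (delete ord0 f).
Proof.
rewrite (deleteE _ (delete_arity n.+1)) (deleteE _ (delete_arity n)) /padl.
have -> : lift ord0 ord0 = inner_slot (pad_arity n.+1) ord_max ord0.
  exact: val_inj.
exact: op_circA.
Qed.

Lemma delete_dup n (i : 'I_2) (f : P n.+1) :
  delete (widen_ord (isT : 2 <= n.+2)%N i) (dup f) = f.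
Proof.
have e : 2 = (2 + 0)%N by [].
have e' : n.+2 = (n.+1 + 1)%N by rewrite addn1.
rewrite (deleteE _ (delete_arity n.+1)) /dup.
have -> : widen_ord (isT : 2 <= n.+2)%N i = inner_slot (dup_arity n) ord0 i.
  exact: val_inj.
by rewrite (op_circA _ _ e e') circ_one one1 op_circ_id.
Qed.

Let d0 n : 'Hom(P n.+1, P n) := delete ord0.
Let d1 n : 'Hom(P n.+2, P n.+1) := delete (lift ord0 ord0).

(** Rank-nullity for [d0], which is onto because [padl] is a section. *)
Lemma dim_ker0 n : (\dim {:P n} + \dim (lker (d0 n)) <= \dim {:P n.+1})%N.
Proof.
rewrite -[lker _]capfv; apply: dimv_img_ker; apply/subvP => f _.
by rewrite -(delete0_padl f) memv_img ?memvf.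
Qed.

(* On the kernel of [d0], [dup - padl] is a section of [d1]. *)
Lemma dim_ker01 n :
  (\dim (lker (d0 n)) + \dim (lker (d0 n.+1) :&: lker (d1 n))
    <= \dim (lker (d0 n.+1)))%N.
Proof.
apply: dimv_img_ker; apply/subvP => f; rewrite memv_ker => /eqP d0f.
apply/memv_imgP; exists (dup f - padl f).
  rewrite memv_ker linearB /= /d0 delete0_padl.
  have -> : ord0 = widen_ord (isT : 2 <= n.+2)%N ord0 by apply: val_inj.
  by rewrite delete_dup subrr.
rewrite linearB /= /d1 delete1_padl.
have -> : lift ord0 ord0 = widen_ord (isT : 2 <= n.+2)%N ord_max.
  exact: val_inj.
rewrite delete_dup [delete _ _]d0f.
by rewrite /padl -[0](scale0r 0) op_circZr scale0r subr0.
Qed.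

(** A dummy last input does not interfere with deleting the first two, and deleting it again
    recovers the element, so [padr] preserves the common kernel and is injective. *)
Lemma ker01_neq0 k (v : P k.+2) j :
  v != 0 -> v \in (lker (d0 k.+1) :&: lker (d1 k))%VS ->
  (0 < \dim (lker (d0 (j + k).+1) :&: lker (d1 (j + k))))%N.
Proof.
move=> v0 vk.
suff [w w0 wk] : exists2 w : P (j + k).+2, w != 0 &
    w \in (lker (d0 (j + k).+1) :&: lker (d1 (j + k)))%VS.
  by rewrite lt0n dimv_eq0; apply: contraNneq w0 => E; rewrite -memv0 -E.
elim: j => [|j [w w0 wk]]; first by exists v.
move: wk; rewrite memv_cap !memv_ker => /andP[/eqP w1 /eqP w2].
exists (padr w).
  by apply: contraNneq w0 => E; rewrite -(delete_max_padr w) E linear0.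
rewrite memv_cap !memv_ker.
have -> : d0 (j.+1 + k).+1 (padr w) = padr (d0 _ w).
  by rewrite -delete_padr; congr (delete _ _); apply: val_inj.
have -> : d1 (j.+1 + k) (padr w) = padr (d1 _ w).
  by rewrite -delete_padr; congr (delete _ _); apply: val_inj.
by rewrite w1 w2 /padr -![0](scale0r 0) !op_circZr !scale0r eqxx.
Qed.

Lemma dim_growth k (v : P k.+2) :
  v != 0 -> v \in (lker (d0 k.+1) :&: lker (d1 k))%VS ->
  forall j, ('C(j, 2) <= \dim {:P (j + k)})%N.
Proof.
move=> v0 vk.
have dk j : (j <= \dim (lker (d0 (j + k))))%N.
  elim: j => // j IH; apply: leq_trans (dim_ker01 _); rewrite -addn1 leq_add //.
  exact: (ker01_neq0 _ v0 vk).
elim=> // j IH; rewrite binS bin1.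
by apply: leq_trans (dim_ker0 _); rewrite leq_add.
Qed.

Lemma sum_dim_growth k (v : P k.+2) :
  v != 0 -> v \in (lker (d0 k.+1) :&: lker (d1 k))%VS ->
  forall j, ('C(j.+1, 3) <= \sum_(i < (j + k).+1) \dim {:P i})%N.
Proof.
move=> v0 vk; elim=> // j IH.
by rewrite big_ord_recr binS /= leq_add // (dim_growth v0 vk j.+1).
Qed.

End Deletion.

(** * From cubic growth to a limsup above 2 *)

Lemma limn_esup_lt_near (R : realType) (u : nat -> \bar R) (l : \bar R) :
  (limn_esup u < l)%E -> (\forall n \near \oo%classic, (u n < l)%E).
Proof.
rewrite /limn_esup /limf_esup => /ereal_inf_lt[_ [V ooV <-]] supl.
apply: filterS ooV => n Vn; apply: le_lt_trans supl.
by apply: ereal_sup_ubound; exists n.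
Qed.

(* 4608 = 12^2 * 2^5 *)
Lemma leq_exp5_bin3_sqr (m : nat) :
  (4608 <= m)%N -> ((2 * m) ^ 5 <= 'C(m.+1, 3) ^ 2)%N.
Proof.
move=> m_ge.
(* $12\binom{m+1}{3}=2(m^3-m)$, which is at least $m^3$ once $m\ge2$. *)
have c12 : (m ^ 3 <= 12 * 'C(m.+1, 3))%N.
  have := bin_ffact m.+1 3; rewrite !factS fact0 !ffactnS ffactn0 /=.
  have := m_ge; case: (m) => // -[//|n] /= _; nia.
have := c12; rewrite -leq_sqr -expnM expnMn expnS => c144.
by have := leq_mul m_ge (leqnn (m ^ 5)); rewrite expnMn; lia.
Qed.

Lemma log_growth_gt2 (R : realType) (S : nat -> nat) k :
  (forall j, 'C(j.+1, 3) <= S (j + k))%N ->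
  (2%:R%:E < limn_esup (fun n => (ln (S n)%:R / ln n%:R : R)%:E))%E.
Proof.
move=> S_ge; rewrite ltNge; apply/negP => le2.
(* Any exponent strictly between 2 and 3 would do; with 5/2 the bound to refute becomes
   $S(n)^2<n^5$, free of real powers. *)
have : (limn_esup (fun n => (ln (S n)%:R / ln n%:R : R)%:E) < (5 / 2)%:E)%E.
  by apply: le_lt_trans le2 _; rewrite lte_fin ltr_pdivlMr // -natrM ltr_nat.
(* The test point is $n=2m$: the three summands of [m] give the numerical inequality, $2m-k\ge m$,
   and $2m\ge N$. *)
case/limn_esup_lt_near => N _ near_lt; pose m := (4608 + k + N)%N.
have /near_lt : (N <= 2 * m)%N by rewrite /m; lia.
apply/negP; rewrite lte_fin -leNgt.
have m2 : (1 < 2 * m)%N by rewrite /m; lia.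
rewrite ler_pdivlMr ?ln_gt0 ?ltr1n // mulrAC ler_pdivrMr //.
have Sm : ((2 * m) ^ 5 <= S (2 * m) ^ 2)%N.
  apply: leq_trans (leq_exp5_bin3_sqr _) _; first by rewrite /m; lia.
  rewrite leq_sqr -(@subnK k (2 * m)); last by rewrite /m; lia.
  by apply: leq_trans (S_ge _); rewrite leq_bin2l // /m; lia.
have S0 : (0 < S (2 * m))%N.
  by rewrite lt0n; apply: contraTneq Sm => ->; rewrite -ltnNge expn_gt0; lia.
have n0 : (0 < 2 * m)%N by lia.
rewrite mulr_natr mulr_natl -!lnXn ?ltr0n //.
by rewrite ler_ln ?posrE ?exprn_gt0 ?ltr0n // -!natrX ler_nat.
Qed.

(** * Rigidity from the Hopf structure *)

Section Rigidity.
Variables (K : fieldType) (P : com_augmented_hopf_operad K).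

Let au := cah_aug P.
Let hs := cah_hopf P.
Let one n : P n := aug_unit au n (1 : K^o).
Let eps n (f : P n) : K := counit hs n f.
Let i1 : 'I_2 := lift ord0 ord0.

Lemma eps_delete n (i : 'I_n.+1) (f : P n.+1) : eps (delete au i f) = eps f.
Proof.
rewrite (deleteE _ _ (delete_arity n)) /eps hom_circ /= cah_counit_unit.
exact: mulr1.
Qed.

Lemma arity0 (f : P 0) : f = eps f *: one 0.
Proof.
have [c ->] : exists c : K, f = c *: one 0.
  rewrite /one (aug_unit0 au).
  by apply/vlineP; rewrite -span_seq1 (span_basis (aug_one0_basis au)) memvf.
by rewrite /eps linearZ cah_counit_unit /= -[_ *: 1]/(c * 1) mulr1.
Qed.

(* f(x) g(y) *)
Definition prod2 (f g : P 1) : P 2 :=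
  op_circ (pad_arity 1) ord_max (padr au f) g.

(** Deleting $y$ turns $g(y)$ into an element of $\mathcal{P}(0)$, that is, the scalar [eps g] times
    $\mathbb{1}_0$. *)
Lemma delete1_prod2 f g : delete au i1 (prod2 f g) = eps g *: f.
Proof.
have e : 1 = (1 + 0)%N by [].
rewrite (deleteE _ _ (delete_arity 1)) /prod2.
have -> : i1 = inner_slot (pad_arity 1) ord_max ord0 by apply: val_inj.
rewrite (op_circA _ _ e (delete_arity 1)) -deleteE [delete _ _ _]arity0.
by rewrite op_circZr -deleteE delete_max_padr eps_delete.
Qed.

Lemma delete0_prod2 f g : delete au ord0 (prod2 f g) = eps f *: g.
Proof.
have ki : (ord0 : 'I_2) != ord_max by [].
have ik : (ord_max : 'I_2) != ord0 by [].
have e : 2 = (1 + 1)%N by [].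
rewrite (deleteE _ _ (delete_arity 1)) /prod2.
have -> : ord0 = outer_slot (pad_arity 1) ki by apply: val_inj.
rewrite (op_circAC _ _ (delete_arity 1) e ki ik) -deleteE.
have -> : delete au ord0 (padr au f) = padr au (delete au ord0 f).
  by rewrite -delete_padr; congr (delete _ _ _); apply: val_inj.
rewrite [delete _ _ _]arity0 eps_delete /padr op_circZr op_circZl.
rewrite circ_one one1 (_ : outer_slot _ _ = ord0) ?op_id_circ //.
exact: val_inj.
Qed.

(* For [A = B = Delta u]: u (x) u is a linear image of Delta (u(x) u(y)). *)
Lemma delete_coprod (A B : tensor (P 1) (P 1)) :
  tmap (delete au i1) (delete au ord0)
    (had_circ (pad_arity 1) ord_max
       (had_circ (pad_arity 1) ord0 (tens (one 2) (one 2)) A) B) =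
  tens (contractr (tmap idfun (counit hs 1) A))
       (contractl (tmap (counit hs 1) idfun B)).
Proof.
elim/tens_ind: A => [a A A' IA IA'|f f'].
  rewrite had_circ_linearr had_circ_linearl [LHS]tlift_linear -/(tmap _ _ _) IA.
  by rewrite -/(tmap _ _ _) IA' /tmap /contractr !tlift_linear tens_linearl.
elim/tens_ind: B => [a B B' IB IB'|g g'].
  rewrite had_circ_linearr [LHS]tlift_linear -/(tmap _ _ _) IB.
  by rewrite -/(tmap _ _ _) IB' /tmap /contractl !tlift_linear tens_linearr.
rewrite !had_circE !tmapE contractlE contractrE.
rewrite -/(eps f') -/(eps g) /=.
(* The tensor factors are [prod2 f g] and [prod2 f' g']. The scalars left by the deletions sit on
   the opposite factors from those of the goal, and move across the tensor sign. *)
transitivity (tens (eps g *: f) (eps f' *: g')).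
  by congr tens; [exact: delete1_prod2|exact: delete0_prod2].
by rewrite !tensZl !tensZr !scalerA mulrC.
Qed.

(** As $\mathbb{1}_2$ is grouplike, the coproduct of [prod2 u u] is the composite in
    [delete_coprod], whose right side the counit laws reduce to $u\otimes u$. *)
Lemma arity1_rigid (u : P 1) : prod2 u u = 0 -> u = 0.
Proof.
move=> uu0; apply: tens_diag_eq0.
have := delete_coprod (coprod hs 1 u) (coprod hs 1 u).
rewrite coprod_counitl coprod_counitr contractlE contractrE !scale1r => <-.
have one2 : coprod hs 2 (one 2) = tens (one 2) (one 2).
  by rewrite /one cah_coprod_unit tmapE.
have <- : coprod hs 2 (prod2 u u) =
    had_circ (pad_arity 1) ord_max
      (had_circ (pad_arity 1) ord0 (tens (one 2) (one 2)) (coprod hs 1 u))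
      (coprod hs 1 u).
  by rewrite /prod2 /padr !hom_circ one2.
rewrite uu0 linear0 -[X in tmap _ _ X](scale0r 0).
exact: etrans (scalable_linear (tlift_linear _) _ _) (scale0r _).
Qed.

(** The hypothesis isolates what the dimension bound provides. It starts in arity 2, so arities 0
    and 1 are treated apart; arity 1 reaches it through [prod2]. *)
Lemma unit_surjective :
  (forall k (v : P k.+2),
    delete au ord0 v = 0 -> delete au (lift ord0 ord0) v = 0 -> v = 0) ->
  forall n (f : P n), f = aug_unit au n (eps f).
Proof.
move=> no_kernel n f.
have unitZ m (c : K) : aug_unit au m c = c *: one m.
  by rewrite /one -linearZ /= -[_ *: 1]/(c * 1) mulr1.
have eps_one m (c : K) : eps (c *: one m) = c.
  by rewrite -unitZ /eps cah_counit_unit.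
rewrite unitZ; elim: n f => [|[|n] IH] f; first exact: arity0.
  have e0 : eps (f - eps f *: one 1) = 0.
    by rewrite {1}/eps linearB /= -/(eps f) -/(eps (_ *: _)) eps_one subrr.
  apply/eqP; rewrite -subr_eq0; apply/eqP; apply: arity1_rigid.
  apply: no_kernel.
    by rewrite delete0_prod2 e0 scale0r.
  by rewrite delete1_prod2 e0 scale0r.
apply/eqP; rewrite -subr_eq0; apply/eqP; apply: no_kernel;
  by rewrite linearB linearZ /= delete_one [delete _ _ f]IH eps_delete subrr.
Qed.

End Rigidity.

Theorem proposition5p3 (R : realType) (K : fieldType)
  (P : com_augmented_hopf_operad K) :
  (GKdim R P <= 2%:R%:E)%E -> is_operad_iso (aug_unit (cah_aug P)).
Proof.
move=> GK2; exists (counit (cah_hopf P)) => n; split=> [a|f].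
  exact: cah_counit_unit.
symmetry; apply: unit_surjective => k v v0 v1.
(* A nonzero [v] killed by both deletions would push the dimension above 2. *)
apply: contraTeq GK2 => vn0; rewrite -ltNge.
apply: (@log_growth_gt2 _ (fun n => \sum_(i < n.+1) \dim {:P i})%N k).
apply: (@sum_dim_growth _ _ (cah_aug P) _ v) => //.
by rewrite memv_cap !memv_ker v0 v1 eqxx.
Qed.
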